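(* Let $d\ge1$, let $\mathcal{A} \subseteq \mathbb{R}^d \times \mathbb{R}$ be a generic thin Delone set of weighted points with set of locations $A \subseteq \mathbb{R}^d$, let $k \ge 0$ be an integer, and let $a$ be the location of a weighted point of $\mathcal{A}$. Then the simplices of $\mathcal{A}$ with heft $k$ cover $\mathbb{R}^d$ exactly $\binom{d+k}{d}$ times, i.e. every $x\in\mathbb{R}^d$ with $x\notin A$ and $A\cup\{x\}$ generic lies in exactly $\binom{d+k}{d}$ simplices of heft $k$; and the simplices of $\mathcal{A}$ with heft at most $k$ having $a$ as a vertex cover every sufficiently small neighborhood of $a$ at most $\binom{d+k}{d}$ times.
   Context: A weighted point is $\mathbf{b}=(b,r_b^2)$ with location $b\in\mathbb{R}^d$ and real weight $r_b^2$ (possibly negative). Two weighted points $(a,r_a^2),(b,r_b^2)$ are orthogonal if $\|a-b\|^2=r_a^2+r_b^2$. A point set $A\subseteq\mathbb{R}^d$ is a thin Delone set if every closed ball contains finitely many points of $A$ and every closed half-space contains at least one point of $A$; it is generic if no $d+1$ points lie on a common affine hyperplane and no $d+2$ on a common $(d-1)$-sphere. A set $\mathcal{A}$ of weighted points (distinct locations) is a thin Delone set of weighted points if its set of locations $A$ is thin Delone and the absolute values of the weights are bounded; it is generic if $A$ is generic and for every $d+1$ weighted points of $\mathcal{A}$ there is a unique weighted point orthogonal to each of them, distinct for distinct $(d+1)$-tuples. The $d$-simplex defined by $d+1$ weighted points of $\mathcal{A}$ is the convex hull of their locations; its heft is the number of weighted points $(b,r_b^2)\in\mathcal{A}$ with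 $\|x-b\|^2-r_x^2-r_b^2<0$, where $(x,r_x^2)$ is the unique weighted point orthogonal to the $d+1$ weighted points. *)

(* Defs.v *)
From HB Require Import structures.
From mathcomp Require Export all_boot all_order all_algebra.
From mathcomp Require Export finmap.
From mathcomp Require Export mathcomp_extra boolp classical_sets functions.
From mathcomp Require Export cardinality reals topology normedtype.

Set Implicit Arguments.
Unset Strict Implicit.
Unset Printing Implicit Defensive.

Import Order.TTheory GRing.Theory Num.Theory.
Export numFieldNormedType.Exports.

Local Open Scope classical_set_scope.
Local Open Scope ring_scope.

Section WeightedDelone.
Context {R : realType} {d : nat}.

Definition dotv (u v : 'rV[R]_d) : R := \sum_(i < d) u 0 i * v 0 i.

(* The Euclidean norm; the library norm on matrices is the sup norm. *)
Definition sqnorm (u : 'rV[R]_d) : R := dotv u u.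
Definition enorm (u : 'rV[R]_d) : R := Num.sqrt (sqnorm u).

Definition closed_eball (c : 'rV[R]_d) (r : R) : set 'rV[R]_d :=
  [set x | enorm (x - c) <= r].

Definition esphere (c : 'rV[R]_d) (r : R) : set 'rV[R]_d :=
  [set x | enorm (x - c) = r].

Definition hyperplane (u : 'rV[R]_d) (c : R) : set 'rV[R]_d :=
  [set x | dotv u x = c].

Definition closed_halfspace (u : 'rV[R]_d) (c : R) : set 'rV[R]_d :=
  [set x | dotv u x <= c].

Definition thin_delone (A : set 'rV[R]_d) : Prop :=
  (forall c r, finite_set (A `&` closed_eball c r)) /\
  (forall (u : 'rV[R]_d) (c : R), u != 0 -> A `&` closed_halfspace u c !=set0).

Definition generic (A : set 'rV[R]_d) : Prop :=
  (forall S : {fset 'rV[R]_d}, [set` S] `<=` A -> #|` S|%fset = d.+1 ->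
     forall (u : 'rV[R]_d) (c : R), u != 0 -> ~ ([set` S] `<=` hyperplane u c)) /\
  (forall S : {fset 'rV[R]_d}, [set` S] `<=` A -> #|` S|%fset = d.+2 ->
     forall (c : 'rV[R]_d) (r : R), 0 < r -> ~ ([set` S] `<=` esphere c r)).

(* A pair (b, w) is the weighted point with location b and weight w; the weight
   is what is traditionally written as a square r_b^2, but it may be negative. *)
Definition power (p q : 'rV[R]_d * R) : R := enorm (p.1 - q.1) ^+ 2 - p.2 - q.2.

Definition orthogonal (p q : 'rV[R]_d * R) : Prop :=
  enorm (p.1 - q.1) ^+ 2 = p.2 + q.2.

Definition orthogonal_to_all (S : {fset 'rV[R]_d * R}) (z : 'rV[R]_d * R) : Prop :=
  forall p : 'rV[R]_d * R, p \in S -> orthogonal z p.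

Definition locations (AA : set ('rV[R]_d * R)) : set 'rV[R]_d := fst @` AA.

Definition distinct_locations (AA : set ('rV[R]_d * R)) : Prop :=
  forall p q, AA p -> AA q -> p.1 = q.1 -> p = q.

Definition wthin_delone (AA : set ('rV[R]_d * R)) : Prop :=
  [/\ distinct_locations AA,
      thin_delone (locations AA) &
      exists M : R, forall p, AA p -> `|p.2| <= M].

(* A d-simplex of AA is represented by its set of d+1 weighted vertices. *)
Definition simplices (AA : set ('rV[R]_d * R)) : set {fset 'rV[R]_d * R} :=
  [set S | [set` S] `<=` AA /\ #|` S|%fset = d.+1].

Definition wgeneric (AA : set ('rV[R]_d * R)) : Prop :=
  [/\ generic (locations AA),
      forall S, simplices AA S -> exists! z, orthogonal_to_all S z &
      forall S T z, simplices AA S -> simplices AA T ->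
        orthogonal_to_all S z -> orthogonal_to_all T z -> S = T].

Definition simplex_hull (S : {fset 'rV[R]_d * R}) : set 'rV[R]_d :=
  [set x | exists t : 'rV[R]_d * R -> R,
     [/\ forall p : 'rV[R]_d * R, p \in S -> 0 <= t p,
         \sum_(p <- S) t p = 1 &
         x = \sum_(p <- S) t p *: p.1]].

(* For generic AA the weighted point z is unique, so this is a partial function
   of S; an infinite count has no heft. *)
Definition has_heft (AA : set ('rV[R]_d * R)) (S : {fset 'rV[R]_d * R})
    (k : nat) : Prop :=
  exists z, orthogonal_to_all S z /\
    ([set b | AA b /\ power z b < 0] #= `I_k)%card.

Definition simplices_heft (AA : set ('rV[R]_d * R)) (k : nat) :
    set {fset 'rV[R]_d * R} :=
  [set S | simplices AA S /\ has_heft AA S k].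

Definition star_heft_le (AA : set ('rV[R]_d * R)) (a : 'rV[R]_d) (k : nat) :
    set {fset 'rV[R]_d * R} :=
  [set S | [/\ simplices AA S,
               exists2 j, (j <= k)%N & has_heft AA S j &
               exists2 p : 'rV[R]_d * R, p \in S & p.1 = a]].

Definition covering_at (F : set {fset 'rV[R]_d * R}) (x : 'rV[R]_d) :
    set {fset 'rV[R]_d * R} :=
  [set S | F S /\ simplex_hull S x].

(* Coverings are only counted at points in general position with respect to A,
   which avoids the boundaries of the simplices. *)
Definition general_position (A : set 'rV[R]_d) (x : 'rV[R]_d) : Prop :=
  ~ A x /\ generic (A `|` [set x]).

Definition covers_exactly (A : set 'rV[R]_d) (F : set {fset 'rV[R]_d * R})
    (U : set 'rV[R]_d) (n : nat) : Prop :=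
  forall x, U x -> general_position A x -> (covering_at F x #= `I_n)%card.

Definition covers_at_most (A : set 'rV[R]_d) (F : set {fset 'rV[R]_d * R})
    (U : set 'rV[R]_d) (n : nat) : Prop :=
  forall x, U x -> general_position A x -> (covering_at F x #<= `I_n)%card.

End WeightedDelone.

(* Main.v *)
Require Import Defs.
From mathcomp Require Import derive zify lra.

(** Fix [x] in general position. For every finite set [V] of points of the thin
    Delone set [A], the set [A] minus [V] is again thin Delone, so it has exactly
    one (weighted) Delaunay simplex covering [x]: existence is linear programming
    (the highest affine function at [x] below the lifted points), uniqueness is
    convexity plus genericity. Writing [W] for the points counted by the heft of a
    simplex [S], this says that exactly one covering simplex has [W] inside [V] and
    [S] disjoint from [V]. Counting the pairs ([V], [S]) with [V] an [r]-subset of a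
    large [n]-set yields
      [C(n, r) = sum_k E_k C(n - d - 1 - k, r - k)]
    for the number [E_k] of simplices of heft [k] covering [x], which forces
    [E_k = C(d + k, d)]. The bound on stars follows by comparing the counts for [A]
    and for [A] minus the vertex, and it holds at every [x], near [a] or not. *)

Set Implicit Arguments.
Unset Strict Implicit.
Unset Printing Implicit Defensive.

Import Order.TTheory GRing.Theory Num.Theory.

(** * Counting subsets *)

Lemma sum_bin_diag (d n : nat) : \sum_(k < n.+1) 'C(d + k, d) = 'C(d.+1 + n, n).
Proof.
elim: n => [|n IHn]; first by rewrite big_ord1 /= !addn0 binn bin0.
rewrite big_ord_recr /= IHn [in RHS]addnS binS addnC addSnnS; congr (_ + _).
by rewrite -(bin_sub (leq_addr n.+1 d)) addKn.
Qed.

(** Classify the [r]-subsets of [d.+1 + m] ordered elements by the number [k] of members preceding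
    the [d.+1]-st nonmember, which exists because [r <= m]. The proof itself is Pascal's rule and
    induction on [m]. *)
Lemma sum_bin_mul_bin (d m r : nat) : r <= m ->
  \sum_(k < r.+1) 'C(d + k, d) * 'C(m - k, r - k) = 'C(d.+1 + m, r).
Proof.
elim: m r => [|m IHm] [|r] //; try by move=> _; rewrite big_ord1 /= !bin0 addn0 binn.
rewrite leq_eqVlt => /orP[/eqP <-|ltrm].
  by rewrite -sum_bin_diag; apply: eq_bigr => k _; rewrite binn muln1.
rewrite addnS binS -(IHm r.+1)// -(IHm r) 1?ltnW// big_ord_recr /=.
rewrite [in X in _ = X + _]big_ord_recr /= !subnn !bin0 addnAC -big_split /=.
congr (_ + _); apply: eq_bigr => k _; rewrite -mulnDr.
have lekr : k <= r by rewrite -ltnS.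
by rewrite (subSn lekr) subSn ?binS//; lia.
Qed.

(** [V |-> V :\: W] is a bijection onto the subsets of the complement of [S :|: W] with [r - #|W|]
    elements. *)
Lemma card_draws_between (X : finType) (S W : {set X}) (r : nat) :
  [disjoint S & W] -> #|W| <= r ->
  #|[set V : {set X} | [&& #|V| == r, W \subset V & [disjoint S & V]]]| =
    'C(#|X| - #|S| - #|W|, r - #|W|).
Proof.
move=> dSW leWr.
have -> : #|X| - #|S| - #|W| = #|~: (S :|: W)|.
  rewrite -subnDA [RHS]cardsCs finset.setCK cardsU; move: dSW; rewrite -setI_eq0 => /eqP->.
  by rewrite cards0 subn0.
rewrite -cards_draws -(card_in_imset (f := fun V => V :\: W)); last first.
  move=> V V'; rewrite !inE => /and3P[_ sWV _] /and3P[_ sWV' _] /= eqV.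
  rewrite -(finset.setID V W) -(finset.setID V' W).
  by rewrite (finset.setIidPr sWV) (finset.setIidPr sWV') eqV.
apply: eq_card => V; rewrite [RHS]inE; apply/imsetP/andP.
  move=> [U]; rewrite inE => /and3P[/eqP cU sWU dSU] ->; split; last first.
    by rewrite cardsD (finset.setIidPr sWU) cU.
  apply/fintype.subsetP => y; rewrite !inE negb_or => /andP[-> yU]; rewrite andbT.
  by apply: contraL yU => /(disjointFr dSU)->.
move=> [/fintype.subsetP sV /eqP cV]; have VSW y : y \in V -> (y \notin S) && (y \notin W).
  by move=> /sV; rewrite !inE negb_or.
have dVW : V :&: W = finset.set0.
  by apply/setP => y; rewrite !inE; apply/negP => /andP[/VSW/andP[_ /negP]].
exists (V :|: W); rewrite ?inE.
  rewrite finset.subsetUr cardsU dVW cards0 subn0 cV subnK ?eqxx//=.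
  rewrite -setI_eq0; apply/eqP/setP => y; rewrite !inE.
  apply/negP => /andP[yS /orP[/VSW|yW]]; first by rewrite yS.
  by rewrite (disjointFr dSW yS) in yW.
apply/setP => y; rewrite !inE; case yV: (y \in V) => /=; last by rewrite andNb.
by have /andP[_ ->] := VSW _ yV.
Qed.

Section UniqueDraw.
Variables (I X : finType) (S W : I -> {set X}) (d r : nat).
Hypothesis cardS : forall i, #|S i| = d.+1.
Hypothesis disjSW : forall i, [disjoint S i & W i].
Hypothesis leWr : forall i, #|W i| <= r.
Hypothesis uniqV : forall V : {set X}, #|V| = r ->
  exists! i, W i \subset V /\ [disjoint S i & V].

Lemma sum_unique_draw :
  \sum_i 'C(#|X| - d.+1 - #|W i|, r - #|W i|) = 'C(#|X|, r).
Proof.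
transitivity (\sum_i \sum_(V : {set X} | #|V| == r)
    ((W i \subset V) && [disjoint S i & V] : nat)).
  apply: eq_bigr => i _; rewrite -(cardS i) -card_draws_between//.
  rewrite -sum1_card -big_mkcondr; apply: eq_big => // V; rewrite !inE.
  by case: (#|V| == r).
rewrite exchange_big /= -(card_draws X r) -sum1_card; apply: eq_big => [V|V].
  by rewrite inE.
move=> /eqP/uniqV[i [[Wi Si] uniqi]]; rewrite (bigD1 i)//= Wi Si big1 // => j.
move=> neji; case: andP => // /uniqi eqij; by rewrite eqij eqxx in neji.
Qed.

(** Grouped by [k = #|W i|], the sum of [sum_unique_draw] must equal that of [sum_bin_mul_bin] with
    [m = #|X| - d.+1]. The terms with [k < r] agree, and at [k = r] the second factor is [1] on both
    sides. *)
Lemma card_unique_draw : d.+1 + r <= #|X| ->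
  (forall k, k < r -> #|[set i | #|W i| == k]| = 'C(d + k, d)) ->
  #|[set i | #|W i| == r]| = 'C(d + r, d).
Proof.
move=> leX IH; set m := #|X| - d.+1.
have lerm : r <= m by rewrite /m; lia.
have := sum_unique_draw; rewrite -/m.
have -> : #|X| = d.+1 + m by rewrite /m; lia.
rewrite -sum_bin_mul_bin//.
rewrite (partition_big (fun i => (inord #|W i| : 'I_r.+1)) predT)//=.
rewrite (eq_bigr (fun k : 'I_r.+1 => #|[set i | #|W i| == k]| * 'C(m - k, r - k))).
  rewrite !big_ord_recr /= !subnn !bin0 !muln1.
  rewrite (eq_bigr (fun k : 'I_r => 'C(d + k, d) * 'C(m - k, r - k))).
    by move/addnI.
  by move=> k _; rewrite IH.
move=> k _; rewrite -sum1_card big_distrl /=; apply: eq_big => [i|i /eqP <-].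
  by rewrite inE -val_eqE /= inordK ?ltnS.
by rewrite mul1n inordK ?ltnS.
Qed.

End UniqueDraw.

Local Open Scope classical_set_scope.
Local Open Scope ring_scope.

(** * Power and lifted heights *)

Section FiniteSets.
Variable T : choiceType.

Lemma fset_upper_bound (R : realDomainType) (F : {fset T}) (f : T -> R) :
  exists2 m, 0 <= m & forall p, p \in F -> f p <= m.
Proof.
have [m m0 hm] : exists2 m, 0 <= m & forall p, p \in (F : seq T) -> f p <= m.
  elim: (F : seq T) => [|q s [m m0 hm]]; first by exists 0.
  exists (Num.max m (f q)); first by rewrite le_max m0.
  by move=> p; rewrite inE le_max => /orP[/eqP->|/hm->//]; rewrite lexx orbT.
by exists m.
Qed.

Lemma fset_common_radius (R : realDomainType) (F : {fset T}) (Q : T -> R -> Prop) :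
  (forall p, p \in F -> exists2 e0, 0 < e0 & forall e, 0 < e <= e0 -> Q p e) ->
  exists2 e, 0 < e & forall p, p \in F -> Q p e.
Proof.
move=> hQ.
have [e e0 he] : exists2 e0, 0 < e0 &
    forall e p, 0 < e <= e0 -> p \in (F : seq T) -> Q p e.
  have : forall p, p \in (F : seq T) ->
    exists2 e0, 0 < e0 & forall e, 0 < e <= e0 -> Q p e by [].
  elim: (F : seq T) => [|q s IHs] hs; first by exists 1.
  have [p ps|e1 e1_gt0 he1] := IHs; first by apply: hs; rewrite inE ps orbT.
  have [e2 e2_gt0 he2] := hs q (mem_head _ _).
  exists (Num.min e1 e2); first by rewrite lt_min e1_gt0.
  move=> e p /andP[e_gt0]; rewrite le_min inE => /andP[ee1 ee2].
  by move=> /orP[/eqP->|ps]; [apply: he2 | apply: he1]; rewrite ?e_gt0.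
by exists e => // p pF; apply: he; rewrite ?e0 ?lexx.
Qed.

Lemma fsubset_of_card (P : {fset T}) (n : nat) : (n <= #|` P|)%N ->
  exists2 S : {fset T}, (S `<=` P)%fset & #|` S| = n.
Proof.
move=> nP; exists [fset p in take n P]%fset.
  by apply/fsubsetP => p; rewrite !inE => /mem_take.
by rewrite card_fseq undup_id ?take_uniq// size_take_min; exact/minn_idPl.
Qed.

Lemma fsuperset_of_card (A : set T) (P : {fset T}) (n : nat) :
  (forall F : {fset T}, exists2 p, A p & p \notin F) ->
  [set` P] `<=` A -> (#|` P| <= n)%N ->
  exists S : {fset T}, [/\ (P `<=` S)%fset, [set` S] `<=` A & #|` S| = n].
Proof.
move=> infA PA; elim: n => [|n IHn].
  by rewrite leqn0 => cP; exists P; rewrite (eqP cP); split.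
rewrite leq_eqVlt => /orP[/eqP cP|/IHn[S [PS SA cS]]]; first by exists P; split.
have [p Ap pS] := infA S; exists (p |` S)%fset; split.
- exact: fsubset_trans PS (fsubsetU1 _ _).
- by move=> q /=; rewrite !inE => /orP[/eqP->//|/SA].
- by rewrite cardfsU1 pS cS.
Qed.

End FiniteSets.

Section Geometry.
Context {R : realType} {d : nat}.
Local Notation pt := ('rV[R]_d * R)%type.
Implicit Types (u v x y : 'rV[R]_d) (p q b z : pt) (S T P F : {fset pt}).

Lemma dotvE u v : dotv u v = (u *m v^T) 0 0.
Proof. by rewrite mxE; apply: eq_bigr => i _; rewrite mxE. Qed.

Lemma dotvC u v : dotv u v = dotv v u.
Proof. by apply: eq_bigr => i _; rewrite mulrC. Qed.

Lemma dotvDl u v y : dotv (u + v) y = dotv u y + dotv v y.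
Proof. by rewrite !dotvE mulmxDl mxE. Qed.

Lemma dotvZl e u v : dotv (e *: u) v = e * dotv u v.
Proof. by rewrite !dotvE -scalemxAl mxE. Qed.

Lemma dotvNl u v : dotv (- u) v = - dotv u v.
Proof. by rewrite -scaleN1r dotvZl mulN1r. Qed.

Lemma dotvBl u v y : dotv (u - v) y = dotv u y - dotv v y.
Proof. by rewrite dotvDl dotvNl. Qed.

Lemma dotvBr u v y : dotv y (u - v) = dotv y u - dotv y v.
Proof. by rewrite dotvC dotvBl !(dotvC y). Qed.

Lemma dotv0l v : dotv 0 v = 0.
Proof. by rewrite -(subrr 0) dotvBl subrr. Qed.

Lemma dotv_sumr (I : Type) (s : seq I) (t : I -> R) (f : I -> 'rV[R]_d) v :
  dotv v (\sum_(i <- s) t i *: f i) = \sum_(i <- s) t i * dotv v (f i).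
Proof.
elim: s => [|i s IHs]; first by rewrite !big_nil dotvC dotv0l.
by rewrite !big_cons dotvC dotvDl dotvZl !(dotvC _ v) IHs.
Qed.

Lemma sqnorm_ge0 u : 0 <= sqnorm u.
Proof. by apply: sumr_ge0 => i _; rewrite -expr2 sqr_ge0. Qed.

Lemma sqr_enorm u : enorm u ^+ 2 = sqnorm u.
Proof. by rewrite sqr_sqrtr// sqnorm_ge0. Qed.

Lemma le_coord_norm v i : `|v 0 i| <= `|v|.
Proof.
by rewrite [leRHS]/Num.norm/= mx_normrE (le_bigmax _ (fun ij => `|v ij.1 ij.2|) (0, i)).
Qed.

(* With [z = (x + v, s + |v|^2)], the power of [p] to [z] is [pheight x v p - s]:
   the lift of [p] minus the linear function of gradient [2 v], at [p - x]. *)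
Definition pheight x v p : R := sqnorm (p.1 - x) - 2 * dotv v (p.1 - x) - p.2.

Lemma power_pheight x v s p : power (x + v, s + sqnorm v) p = pheight x v p - s.
Proof.
rewrite /power /pheight sqr_enorm /=.
have -> : x + v - p.1 = v - (p.1 - x) by rewrite opprB addrCA addrA.
rewrite {1}/sqnorm dotvBl !dotvBr (dotvC (p.1 - x) v) -/(sqnorm _) /sqnorm.
rewrite !dotvBr !dotvBl; lra.
Qed.

Lemma powerE x z p :
  power z p = pheight x (z.1 - x) p - (z.2 - sqnorm (z.1 - x)).
Proof. by rewrite -power_pheight subrK addrC subrK; case: z. Qed.

Lemma orthogonalP z p : orthogonal z p <-> power z p = 0.
Proof. rewrite /orthogonal /power; split; lra. Qed.

Lemma pheightD x u v e p :
  pheight x (u + e *: v) p = pheight x u p - 2 * e * dotv v (p.1 - x).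
Proof. rewrite /pheight dotvDl dotvZl; lra. Qed.

(** With [y = p.1 - x], use [4 v_i y_i <= y_i^2 + 4 v_i^2] in each coordinate; the factor [d]
    appears because [|v|] is the sup norm. The bound is uniform over a ball of gradients, so only
    finitely many points compete for the minimum there. *)
Lemma pheight_lower_bound x v p M r : p.2 <= M -> `|v| <= r ->
  sqnorm (p.1 - x) / 2 - 2 * (r ^+ 2 * d%:R) - M <= pheight x v p.
Proof.
move=> pM vr; rewrite /pheight.
suff : 2 * dotv v (p.1 - x) <= sqnorm (p.1 - x) / 2 + 2 * (r ^+ 2 * d%:R) by lra.
have -> : r ^+ 2 * d%:R = \sum_(i < d) r ^+ 2.
  by rewrite sumr_const card_ord mulr_natr.
rewrite /sqnorm /dotv mulr_suml !mulr_sumr -big_split /=; apply: ler_sum => i _.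
set y := (p.1 - x) 0 i; have := le_trans (le_coord_norm v i) vr.
rewrite ler_norml => /andP[h1 h2].
have : 0 <= (y - 2 * v 0 i) ^+ 2 by rewrite sqr_ge0.
have : 0 <= (r - v 0 i) * (r + v 0 i) by apply: mulr_ge0; lra.
rewrite !expr2; lra.
Qed.

Lemma dotvl_continuous y : continuous (fun v => dotv v y).
Proof.
rewrite /dotv; elim: (index_enum _) => [|i s IHs].
  by under eq_fun do rewrite big_nil; exact: cst_continuous.
under eq_fun do rewrite big_cons.
move=> v; apply: (continuousD (f := fun v : 'rV[R]_d => v 0 i * y 0 i)); last exact: IHs.
apply: (continuousM (s := fun v : 'rV[R]_d => v 0 i) (t := cst (y 0 i))).
  exact: coord_continuous.
exact: cst_continuous.
Qed.

Lemma pheight_continuous x p : continuous (fun v => pheight x v p).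
Proof.
have -> : (fun v => pheight x v p) =
    (fun v => sqnorm (p.1 - x) - p.2 + dotv v (- 2 *: (p.1 - x))).
  by apply/funext => v; rewrite /pheight (dotvC v (_ *: _)) dotvZl dotvC; lra.
move=> v; apply: (continuousD (f := fun _ : 'rV[R]_d => sqnorm (p.1 - x) - p.2)
  (g := fun v : 'rV[R]_d => dotv v (- 2 *: (p.1 - x)))); first exact: cst_continuous.
exact: dotvl_continuous.
Qed.

Lemma bigmin_pheight_continuous x p0 (s : seq pt) :
  continuous (fun v => \big[Num.min/pheight x v p0]_(p <- s) pheight x v p).
Proof.
elim: s => [|q s IHs].
  by under eq_fun do rewrite big_nil; exact: pheight_continuous.
under eq_fun do rewrite big_cons.
move=> v; apply: (@continuous_min R _ (fun v => pheight x v q : R^o)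
  (fun v => \big[Num.min/pheight x v p0]_(p <- s) pheight x v p : R^o)).
  exact: pheight_continuous.
exact: IHs.
Qed.

End Geometry.

(** * Delaunay simplices *)

Section GeneralPosition.
Context {R : realType} {d : nat}.
Hypothesis d_gt0 : (0 < d)%N.
Local Notation pt := ('rV[R]_d * R)%type.
Implicit Types (A : set pt) (u v x y : 'rV[R]_d) (p q b z : pt) (S T P F : {fset pt}).

Definition generic_at A x : Prop :=
  [/\ wthin_delone A, wgeneric A & general_position (locations A) x].

Lemma locations_sub A B : A `<=` B -> locations A `<=` locations B.
Proof. by move=> AB y [p Ap <-]; exists p => //; exact: AB. Qed.

Lemma generic_sub (A B : set 'rV[R]_d) : A `<=` B -> generic B -> generic A.
Proof. by move=> AB [h1 h2]; split=> S SA; [apply: h1|apply: h2] => y /SA/AB. Qed.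

(** Only the half-space condition does not pass to subsets by itself: lowering the level of the
    half-space beneath all points of [F] yields a point outside [F]. *)
Lemma generic_at_setD A x F : generic_at A x -> generic_at (A `\` [set` F]) x.
Proof.
move=> [[inj [fin half] [M hM]] [gen ex uni] [Ax genx]].
have AFA : A `\` [set` F] `<=` A by exact: subDsetl.
have LFL := locations_sub AFA.
have simpA S : simplices (A `\` [set` F]) S -> simplices A S.
  by move=> [SA cS]; split => // p /SA [].
split; first split.
- by move=> p q /AFA Ap /AFA Aq; exact: inj.
- split=> [c r|u c u0].
    by apply: sub_finite_set (fin c r) => y [/LFL Ly cy].
  have [m m_ge0 hm] := fset_upper_bound F (fun p => - dotv u p.1).
  have [_ [[p Ap <-] hp]] := half u (Num.min c (- m - 1)) u0.
  move: hp; rewrite /closed_halfspace /= le_min => /andP[pc pm].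
  exists p.1; split=> //; exists p => //; split=> //= /hm.
  by lra.
- by exists M => p /AFA; exact: hM.
- split.
  + exact: generic_sub LFL gen.
  + by move=> S /simpA; exact: ex.
  + by move=> S T z /simpA hS /simpA hT; exact: uni.
- split; first by move=> /LFL.
  by apply: generic_sub genx; exact: setSU.
Qed.

Lemma const_mx1_neq0 : const_mx 1 != 0 :> 'rV[R]_d.
Proof.
apply/eqP => /rowP /(_ (Ordinal d_gt0)); rewrite !mxE => /eqP.
by rewrite oner_eq0.
Qed.

Lemma exists_notin_fset A x F : generic_at A x -> exists2 p, A p & p \notin F.
Proof.
move=> /(generic_at_setD F)[[_ [_ half] _] _ _].
have [_ [[p [Ap /negP pF] _] _]] := half (const_mx 1) 0 const_mx1_neq0.
by exists p.
Qed.

Section Independence.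
Variables (A : set pt) (x : 'rV[R]_d).
Hypothesis gA : generic_at A x.
Variable P : {fset pt}.
Hypotheses (PA : [set` P] `<=` A) (cardP : #|` P|%fset = d).

Let p0 : pt := (0, 0).
Let Y : 'M[R]_d := \matrix_(i < d) ((nth p0 P i).1 - x).

(** A nonzero [u] orthogonal to all rows would put [x] and the locations of [P], which are [d.+1]
    distinct points, on one hyperplane, against general position. Hence the vectors [p.1 - x] form a
    basis. *)
Let Y_unit : Y \in unitmx.
Proof.
rewrite -unitmx_tr -row_free_unit; apply: inj_row_free => u uY.
have [[inj _ _] _ [Ax [genx _]]] := gA.
apply/eqP/negPn/negP => u0.
have uP p : p \in P -> dotv u p.1 = dotv u x.
  move=> pP; have ip : (index p P < d)%N by move: pP; rewrite -index_mem cardP.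
  move/rowP: uY => /(_ (Ordinal ip)).
  rewrite mxE [RHS]mxE => uYp; apply/eqP; rewrite -subr_eq0 -dotvBr -[X in _ == X]uYp.
  by apply/eqP/eq_bigr => i _; rewrite !mxE nth_index.
apply: (genx (x |` [fset p.1 | p in P])%fset _ _ u (dotv u x) u0).
- move=> y /=; rewrite !inE => /orP[/eqP ->|/imfsetP[p /= pP ->]]; first by right.
  by left; exists p => //; exact: PA.
- rewrite cardfsU1 card_in_imfset /=; last first.
    by move=> p q pP qP; apply: inj; exact: PA.
  suff -> : x \notin [fset p.1 | p in P]%fset by rewrite cardP.
  by apply/negP => /imfsetP[p /= /PA pA xp]; apply: Ax; exists p.
- move=> y /=; rewrite !inE => /orP[/eqP ->//|/imfsetP[p /= pP ->]]; exact: uP.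
Qed.

Lemma exists_dotv (c : pt -> R) :
  exists v, forall p, p \in P -> dotv v (p.1 - x) = c p.
Proof.
exists ((\row_i c (nth p0 P i)) *m invmx Y^T) => p pP.
have ip : (index p P < d)%N by move: pP; rewrite -index_mem cardP.
have : (\row_i c (nth p0 P i)) *m invmx Y^T *m Y^T = \row_i c (nth p0 P i).
  by rewrite mulmxKV ?unitmx_tr.
move/rowP => /(_ (Ordinal ip)); rewrite [RHS]mxE /= nth_index// => <-.
rewrite mxE; apply: eq_bigr => i _; rewrite [X in _ = _ * X]mxE [X in _ = _ * X]mxE.
by rewrite nth_index.
Qed.

Lemma exists_span y :
  exists mu : pt -> R, y = \sum_(p <- P) mu p *: (p.1 - x).
Proof.
pose m := y *m invmx Y.
exists (fun p => if insub (index p P) is Some i then m 0 i else 0).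
rewrite -[LHS](mulmxKV Y_unit) mulmx_sum_row (big_nth p0) cardP big_mkord.
apply: eq_bigr => i _; rewrite rowK index_uniq ?fset_uniq ?cardP//.
by case: insubP => [j _ /val_inj->//|]; rewrite ltn_ord.
Qed.

End Independence.

Lemma simplex_hullP S x (t : pt -> R) : \sum_(p <- S) t p = 1 ->
  x = \sum_(p <- S) t p *: p.1 <-> \sum_(p <- S) t p *: (p.1 - x) = 0.
Proof.
move=> t1; under [in X in _ <-> X]eq_bigr do rewrite scalerBr.
rewrite sumrB -scaler_suml t1 scale1r; split=> [<-|/subr0_eq //]; exact: subrr.
Qed.

(** If the weight at [q] vanished, the other [d] vertices would carry all of it; a [v] with
    [dotv v (p.1 - x) = 1] on them, given by independence, yields [1 = 0]. *)
Lemma simplex_weight_gt0 A x S (t : pt -> R) : generic_at A x -> simplices A S ->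
  (forall p, p \in S -> 0 <= t p) -> \sum_(p <- S) t p = 1 ->
  \sum_(p <- S) t p *: (p.1 - x) = 0 -> forall p, p \in S -> 0 < t p.
Proof.
move=> gA [SA cS] t0 t1 tx q qS; rewrite lt_neqAle t0// andbT.
apply/negP => /eqP tq.
have PA : [set` (S `\ q)%fset] `<=` A.
  by move=> p /=; rewrite !inE => /andP[_ /SA].
have cP : #|` (S `\ q)%fset| = d by move: cS; rewrite (cardfsD1 q) qS => -[].
have [v hv] := exists_dotv gA PA cP (fun=> 1).
have : dotv v (\sum_(p <- S) t p *: (p.1 - x)) = 0.
  by rewrite tx dotvC dotv0l.
rewrite dotv_sumr (big_fsetD1 q)//= -tq mul0r add0r.
under eq_big_seq => p pS do rewrite hv// mulr1.
move: t1; rewrite (big_fsetD1 q)//= -tq add0r => -> /eqP.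
by rewrite oner_eq0.
Qed.

(** Averaging at [x] kills the linear part of the power, so [z] enters only through the value at [x]
    of its affine function, [z.2 - sqnorm (z.1 - x)]. *)
Lemma sum_power S x z (t : pt -> R) : \sum_(p <- S) t p = 1 ->
  \sum_(p <- S) t p *: (p.1 - x) = 0 ->
  \sum_(p <- S) t p * power z p =
    \sum_(p <- S) t p * (sqnorm (p.1 - x) - p.2) - (z.2 - sqnorm (z.1 - x)).
Proof.
move=> t1 tx; set s := z.2 - _.
transitivity (\sum_(p <- S) (t p * (sqnorm (p.1 - x) - p.2) -
    (2 * (t p * dotv (z.1 - x) (p.1 - x)) + t p * s))).
  by apply: eq_bigr => p _; rewrite (powerE x) /pheight -/s; lra.
rewrite sumrB big_split /= -mulr_sumr -mulr_suml t1 mul1r -dotv_sumr tx.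
by rewrite dotvC dotv0l mulr0 add0r.
Qed.

(* The affine function of [z'] lies below the lifted points, and at [x] it is at
   least as high as that of [z], so it interpolates all the vertices of [S]. *)
Lemma delaunay_unique A x S T z z' : generic_at A x ->
  simplices A S -> simplices A T -> simplex_hull S x -> simplex_hull T x ->
  orthogonal_to_all S z -> orthogonal_to_all T z' ->
  (forall b, A b -> 0 <= power z b) -> (forall b, A b -> 0 <= power z' b) ->
  S = T.
Proof.
move=> gA sS sT [t [t0 t1 /(simplex_hullP _ t1) tx]].
move=> [t' [t'0 t'1 /(simplex_hullP _ t'1) t'x]] oS oT zA z'A.
have SA := sS.1; have TA := sT.1.
have E1 := sum_power z t1 tx; have E2 := sum_power z' t1 tx.
have E3 := sum_power z t'1 t'x; have E4 := sum_power z' t'1 t'x.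
rewrite big1_seq in E1; last first.
  by move=> p /andP[_ pS]; rewrite (orthogonalP z p).1 ?mulr0//; exact: oS.
rewrite big1_seq in E4; last first.
  by move=> p /andP[_ pT]; rewrite (orthogonalP z' p).1 ?mulr0//; exact: oT.
have E3' : 0 <= \sum_(p <- T) t' p * power z p.
  rewrite big_seq; apply: sumr_ge0 => p pT.
  by rewrite mulr_ge0 ?t'0 ?zA//; exact: TA.
have E2' : \sum_(p <- S) t p * power z' p <= 0 by lra.
have [_ _ uni] : wgeneric A by case: gA.
apply: (uni S T z') => // q qS; apply/orthogonalP.
have tq := simplex_weight_gt0 gA sS t0 t1 tx qS.
have : 0 <= \sum_(p <- (S `\ q)%fset) t p * power z' p.
  rewrite big_seq; apply: sumr_ge0 => p; rewrite !inE => /andP[_ pS].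
  by rewrite mulr_ge0 ?t0 ?z'A//; exact: SA.
move: E2'; rewrite (big_fsetD1 q)//= => E2' E5.
have z'q : 0 <= power z' q by apply: z'A; exact: SA.
apply/eqP; rewrite eq_le z'q andbT -(pmulr_rle0 _ tq).
lra.
Qed.

End GeneralPosition.

(** * Existence of a Delaunay simplex by linear programming *)

Section Delaunay.
Context {R : realType} {d : nat}.
Hypothesis d_gt0 : (0 < d)%N.
Local Notation pt := ('rV[R]_d * R)%type.
Implicit Types (A : set pt) (u v x y : 'rV[R]_d) (p q b z : pt) (S T P F : {fset pt}).

(** For each unit [v] the half-space condition gives a point [p] of [A] with [1 < dotv v (p.1 - x)],
    an open condition on [v]. Compactness of the unit sphere leaves finitely many [p], and
    homogeneity extends the bound to all [v != 0]. *)
Lemma finite_halfspace_cover A x : thin_delone (locations A) ->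
  exists2 F : {fset pt}, [set` F] `<=` A &
    forall v, v != 0 -> exists2 p, p \in F & `|v| < dotv v (p.1 - x).
Proof.
move=> [_ half].
have sphere_compact : compact [set v : 'rV[R]_d | `|v| = 1].
  apply: bounded_closed_compact.
    by exists 1; split; [exact: num_real | move=> M M1 v /= ->; exact: ltW].
  rewrite (_ : [set v | _] = (fun v : 'rV[R]_d => `|v|) @^-1` [set 1])//.
  by apply: closed_comp; [move=> v _; exact: norm_continuous | exact: closed_eq].
move: sphere_compact; rewrite compact_cover.
move=> /(_ _ A (fun p => [set v | 1 < dotv v (p.1 - x)])) [p Ap|v v1|F FA cF].
- rewrite (_ : [set v | _] = (fun v => dotv v (p.1 - x)) @^-1` [set r | 1 < r])//.
  by apply: open_comp; [move=> v _; exact: dotvl_continuous | exact: open_gt].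
- have v0 : - v != 0.
    by rewrite oppr_eq0 -normr_eq0 v1 oner_eq0.
  have [_ [[p Ap <-] hp]] := half (- v) (- dotv v x - 2) v0.
  by exists p => //=; move: hp; rewrite /closed_halfspace /= dotvNl dotvBr; lra.
exists F; first by move=> p /FA; rewrite inE.
move=> v v0; have nv0 : 0 < `|v| by rewrite normr_gt0.
have [|p pF] := cF (`|v|^-1 *: v).
  by rewrite /= normrZ normfV normr_id mulVf// gt_eqF.
by rewrite /= dotvZl mulrC ltr_pdivlMr// mul1r => ?; exists p.
Qed.

Lemma finite_bounded_points A x r : wthin_delone A ->
  finite_set [set p | A p /\ sqnorm (p.1 - x) <= r].
Proof.
move=> [inj [fin _] _].
set B := [set p | _]; have injB : {in B &, injective fst}.
  by move=> p q /set_mem[Ap _] /set_mem[Aq _]; exact: inj.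
rewrite -(eq_finite_set (inj_card_eq injB)).
apply: sub_finite_set (fin x (Num.sqrt r)) => _ [p [Ap pr] <-].
by split; [exists p | exact: ler_wsqrtr].
Qed.

(** The default value of the big minimum is the height of a member of [s], so it never undercuts the
    true minimum. *)
Lemma bigmin_pheightP x v p0 (s : seq pt) : p0 \in s ->
  let m := \big[Num.min/pheight x v p0]_(p <- s) pheight x v p in
  (forall p, p \in s -> m <= pheight x v p) /\
  (exists2 p, p \in s & pheight x v p = m).
Proof.
move=> p0s /=; split.
  move=> p; elim: s {p0s} => // q s IHs.
  by rewrite inE big_cons ge_min => /orP[/eqP->|/IHs->]; rewrite ?lexx ?orbT.
suff [p] : exists2 p, p \in p0 :: s &
    pheight x v p = \big[Num.min/pheight x v p0]_(p <- s) pheight x v p.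
  by rewrite inE => /orP[/eqP->|ps] hp; [exists p0 | exists p].
elim: s {p0s} => [|q s [p ps hp]]; first by exists p0; rewrite ?big_nil// mem_head.
rewrite big_cons -hp; case: leP => _; [exists q | exists p] => //.
  by rewrite !inE eqxx orbT.
by move: ps; rewrite !inE => /orP[->//|->]; rewrite !orbT.
Qed.

(* Linear programming: [2 u] is the gradient and [s] the value at [x] of the
   highest affine function below all lifted points; optimality says that no
   direction [v] decreases at all the tight points [P]. *)
Lemma exists_optimum A x : generic_at A x ->
  exists u s (P : {fset pt}),
    [/\ [set` P] `<=` A, forall p, p \in P -> pheight x u p = s,
        forall p, A p -> s <= pheight x u p &
        forall v, exists2 p, p \in P & 0 <= dotv v (p.1 - x)].
Proof.
move=> gA; have [[inj thin [M hM]] _ _] := gA.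
have {}hM p : A p -> - M <= p.2 <= M by move=> /hM; rewrite ler_norml.
have [F FA hF] := finite_halfspace_cover x thin.
have [p0 p0F _] := hF _ (const_mx1_neq0 d_gt0).
have [K0 K0_ge0 hK0] := fset_upper_bound F (fun p => sqnorm (p.1 - x) - p.2).
have M_ge0 : 0 <= M by have := hM _ (FA _ p0F); lra.
(* Gradients with [|v| > r] are too steep: by [low] some point of [F] then falls below [- M],
   whereas at gradient [0] all heights are at least [- M]. *)
pose r := K0 + M.
have low v : r < `|v| -> exists2 p, p \in F & pheight x v p < - M.
  move=> rv; have [|p pF hp] := hF v; first by rewrite -normr_gt0; rewrite /r in rv; lra.
  by exists p => //; have := hK0 _ pF; rewrite /pheight /r in rv *; lra.
have upp v : exists2 p, p \in F & pheight x v p <= K0.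
  have [->|v0] := eqVneq v 0.
    by exists p0 => //; have := hK0 _ p0F; rewrite /pheight dotv0l; lra.
  have [p pF hp] := hF v v0; exists p => //; have := hK0 _ pF.
  by have := normr_ge0 v; rewrite /pheight; lra.
(* By [pheight_lower_bound], points of [A] with [sqnorm (p.1 - x) > Q] stay above [K0] for all
   gradients of norm at most [r], hence above some point of [F] by [upp]. So the finite [F'] decides
   the minimum over [A]. *)
pose Q := 2 * (K0 + M) + 4 * (r ^+ 2 * d%:R).
have finQ : finite_set [set p | A p /\ sqnorm (p.1 - x) <= Q].
  by apply: finite_bounded_points; case: gA.
pose F' : {fset pt} := (F `|` fset_set [set p | A p /\ sqnorm (p.1 - x) <= Q])%fset.
have FF' p : p \in F -> p \in F' by rewrite /F' inE => ->.
have F'A p : p \in F' -> A p.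
  by rewrite /F' in_fsetU in_fset_set// => /orP[/FA//|]; rewrite inE => -[].
have F'far v p : `|v| <= r -> A p -> p \notin F' -> K0 < pheight x v p.
  move=> vr Ap; rewrite /F' in_fsetU in_fset_set// negb_or => /andP[_].
  rewrite notin_setE /= => /not_andP[//|/negP]; rewrite -ltNge => Qp.
  have /andP[_ pM] := hM _ Ap; have := pheight_lower_bound x pM vr.
  by rewrite /Q in Qp; lra.
clearbody F'.
pose G v := \big[Num.min/pheight x v p0]_(p <- F') pheight x v p.
have GP v : (forall p, p \in F' -> G v <= pheight x v p) /\
    (exists2 p, p \in F' & pheight x v p = G v).
  by apply: bigmin_pheightP; exact: FF'.
have ball_compact : compact [set v : 'rV[R]_d | `|v| <= r].
  apply: bounded_closed_compact.
    by exists r; split; [exact: num_real | move=> m rm v /= /le_trans; apply; exact: ltW].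
  rewrite (_ : [set v | _] = (fun v : 'rV[R]_d => `|v|) @^-1` [set y | y <= r])//.
  by apply: closed_comp; [move=> v _; exact: norm_continuous | exact: closed_le].
have ball0 : [set v : 'rV[R]_d | `|v| <= r] 0 by rewrite /= normr0 /r addr_ge0.
have [|u] := compact_EVT_max (ex_intro _ _ ball0) ball_compact (f := G).
  by apply: continuous_subspaceT; exact: bigmin_pheight_continuous.
rewrite inE /= => ur umax.
have GuM : - M <= G u.
  apply: le_trans (umax 0 _); last by rewrite inE.
  have [_ [p /F'A pA <-]] := GP 0; rewrite /pheight dotv0l.
  by have := sqnorm_ge0 (p.1 - x); have := hM _ pA; lra.
exists u, (G u), [fset p in F' | pheight x u p == G u]%fset; split.
- by move=> p /=; rewrite !inE => /andP[/F'A].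
- by move=> p; rewrite !inE => /andP[_ /eqP].
- move=> p Ap; have [pF'|pF'] := boolP (p \in F'); first by apply: (GP u).1.
  have [q /FF' qF' hq] := upp u; apply: le_trans (ltW (F'far u p ur Ap pF')).
  exact: le_trans ((GP u).1 _ qF') hq.
move=> v; apply: contrapT => nv.
have decr p : p \in F' -> pheight x u p = G u -> dotv v (p.1 - x) < 0.
  move=> pF' hp; rewrite ltNge; apply/negP => vp; apply: nv; exists p => //.
  by rewrite !inE pF' hp eqxx.
(* Moving the gradient along [v] raises every tight point, and the other points keep their positive
   slack for small [e]. *)
have [e e0 he] : exists2 e, 0 < e &
    forall p, p \in F' -> G u < pheight x (u + e *: v) p.
  apply: fset_common_radius => p pF'; have := (GP u).1 _ pF'.
  rewrite le_eqVlt => /orP[/eqP hp|hp].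
    exists 1 => // e /andP[e0 _]; rewrite pheightD -hp.
    have /(mulr_gt0 e0) : 0 < - dotv v (p.1 - x).
      by rewrite oppr_gt0 decr.
    by lra.
  set D := pheight x u p - G u; have D0 : 0 < D by rewrite subr_gt0.
  set c := 2 * dotv v (p.1 - x).
  have c0 : 0 < `|c| + 1 by rewrite ltr_wpDl.
  exists (D / (`|c| + 1)); first exact: divr_gt0.
  move=> e /andP[e0]; rewrite ler_pdivlMr// pheightD => eD.
  have : e * c <= e * `|c| by rewrite ler_pM2l// ler_norm.
  by rewrite /D /c in eD *; lra.
(* Inside the ball this contradicts the maximality of [u]; outside, [low] gives a height below
   [- M <= G u]. *)
have [uer|uer] := leP `|u + e *: v| r.
  have [_ [p pF' hp]] := GP (u + e *: v).
  have := he _ pF'; rewrite hp ltNge => /negP; apply.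
  by apply: umax; rewrite inE.
have [p /FF' pF' hp] := low _ uer.
by have := he _ pF'; lra.
Qed.

(** The tight set [P] has exactly [d.+1] points: with fewer, independence gives a [v] negative at
    all of them, against optimality; with more, exchanging one vertex gives a second simplex with
    the same [z], against genericity. *)
Lemma exists_delaunay A x : generic_at A x ->
  exists S z, [/\ simplices A S, simplex_hull S x, orthogonal_to_all S z &
                  forall b, A b -> 0 <= power z b].
Proof.
move=> gA; have [u [s [P [PA Ps sA opt]]]] := exists_optimum gA.
pose z : pt := (x + u, s + sqnorm u).
have zP p : p \in P -> orthogonal z p.
  by move=> pP; apply/orthogonalP; rewrite power_pheight Ps// subrr.
have zA b : A b -> 0 <= power z b.
  by move=> Ab; rewrite power_pheight subr_ge0 sA.
have [_ [_ _ uni] _] := gA.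
have simp S : (S `<=` P)%fset -> #|` S|%fset = d.+1 -> simplices A S.
  by move=> /fsubsetP SP cS; split=> // p /SP/PA.
have [cP|cP|cP] := ltngtP #|` P|%fset d.+1.
- exfalso; have [|P' [/fsubsetP PP' P'A cP']] := fsuperset_of_card (n := d) _ PA cP.
    by move=> F; exact: exists_notin_fset gA.
  have [v hv] := exists_dotv gA P'A cP' (fun=> -1).
  by have [p pP] := opt v; rewrite hv ?PP'//; lra.
- exfalso; have [S SP cS] := fsubset_of_card (ltnW cP).
  have [p pS] : exists p, p \in S.
    by apply/fset0Pn; rewrite -cardfs_gt0 cS.
  have [q qP qS] : exists2 q, q \in P & q \notin S.
    apply/fsubsetPn/negP => /fsubset_leq_card; rewrite cS; by rewrite leqNgt cP.
  have cT : #|` (q |` (S `\ p))%fset| = d.+1.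
    rewrite cardfsU1 !inE (negbTE qS) andbF /= -cS.
    by rewrite (cardfsD1 p S) pS.
  have TP : (q |` (S `\ p) `<=` P)%fset.
    apply/fsubsetP => b; rewrite !inE => /orP[/eqP->//|/andP[_]].
    exact: (fsubsetP SP).
  have /fsetP/(_ q) : S = (q |` (S `\ p))%fset.
    apply: (uni S _ z (simp _ SP cS) (simp _ TP cT)) => b bS; apply: zP.
      exact: (fsubsetP SP).
    exact: (fsubsetP TP).
  by rewrite !inE eqxx (negbTE qS).
exists P, z; split=> //.
have [q qP] : exists q, q \in P by apply/fset0Pn; rewrite -cardfs_gt0 cP.
have P'A : [set` (P `\ q)%fset] `<=` A.
  by move=> p /=; rewrite !inE => /andP[_ /PA].
have cP' : #|` (P `\ q)%fset| = d by move: cP; rewrite (cardfsD1 q) qP => -[].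
have [mu hmu] := exists_span gA P'A cP' (q.1 - x).
(* If [mu p > 0], take [v] equal to [- K] at [p] and [-1] at the other points of [P] except [q]; [K]
   is large enough to make [v] negative at [q] too, against optimality. *)
have mu_le0 p : p \in (P `\ q)%fset -> mu p <= 0.
  move=> pP'; rewrite leNgt; apply/negP => mup.
  pose others := \sum_(b <- (P `\ q `\ p)%fset) mu b.
  pose K := (`|others| + 1) / mu p.
  have K0 : 0 < K by apply: divr_gt0 => //; rewrite ltr_wpDl.
  have [v hv] := exists_dotv gA P'A cP' (fun b => if b == p then - K else -1).
  have [b bP] := opt v; rewrite leNgt => /negP; apply.
  have [->|bq] := eqVneq b q; last first.
    by rewrite hv ?inE ?bq//; case: ifP => _; lra.
  rewrite hmu dotv_sumr (big_fsetD1 p)//= hv// eqxx.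
  under eq_big_seq => c.
    rewrite !inE => /and3P[cp cq cP0].
    rewrite hv ?inE ?cq// (negbTE cp) mulrN1.
    over.
  rewrite sumrN -/others mulrN /K mulrC mulfVK ?gt_eqF//.
  by have := ler_norm (- others); rewrite normrN; lra.
(* The linear relation [hmu] has nonnegative coefficients, [1] at [q] and [- mu p] elsewhere;
   division by their sum [D] gives the barycentric coordinates of [x]. *)
pose D := 1 - \sum_(p <- (P `\ q)%fset) mu p.
have D0 : 0 < D.
  rewrite subr_gt0; apply: le_lt_trans ltr01.
  by rewrite big_seq; apply: sumr_le0 => p; exact: mu_le0.
pose t p := (if p == q then 1 else - mu p) / D.
have t1 : \sum_(p <- P) t p = 1.
  rewrite (big_fsetD1 q)//= /t eqxx -mulr_suml -mulrDl.
  under eq_big_seq => p do [rewrite !inE => /andP[pq _]; rewrite (negbTE pq); over].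
  by rewrite sumrN divff// gt_eqF.
exists t; split=> //.
  move=> p pP; rewrite /t divr_ge0 ?(ltW D0)//; case: eqVneq => // pq.
  by rewrite oppr_ge0 mu_le0// !inE pq.
apply/(simplex_hullP _ t1); rewrite (big_fsetD1 q)//= {1}/t eqxx hmu scaler_sumr.
rewrite -big_split /= big1_seq// => p /andP[_]; rewrite !inE => /andP[pq _].
by rewrite /t (negbTE pq) scalerA -scalerDl mulNr mul1r mulrC subrr scale0r.
Qed.

End Delaunay.

(** * Simplices of higher heft *)

Section CoveringPairs.
Context {R : realType} {d : nat}.
Hypothesis d_gt0 : (0 < d)%N.
Local Notation pt := ('rV[R]_d * R)%type.
Implicit Types (A : set pt) (x : 'rV[R]_d) (p q b z : pt) (S T W V F N : {fset pt}).
Implicit Types c : {fset pt} * {fset pt}.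

(* [(S, W)]: [S] is a simplex covering [x], and [W] is the set counted by its heft. *)
Definition covering_pairs A x : set ({fset pt} * {fset pt}) :=
  [set c | [/\ simplices A c.1, simplex_hull c.1 x &
    exists2 z, orthogonal_to_all c.1 z &
      forall b, (A b /\ power z b < 0) <-> b \in c.2]].

Lemma covering_pairs_inj A x S W W' : generic_at A x ->
  covering_pairs A x (S, W) -> covering_pairs A x (S, W') -> W = W'.
Proof.
move=> [_ [_ ex _] _] [sS _ [z oz zW]] [_ _ [z' oz' z'W']].
have [z0 [_ uz0]] := ex S sS.
have zz' : z = z' by rewrite -(uz0 z oz) -(uz0 z' oz').
apply/fsetP => b; apply/idP/idP => [/zW|/z'W'] h; last by apply/zW; rewrite zz'.
by apply/z'W'; rewrite -zz'.
Qed.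

Lemma covering_pairs_disjoint A x c : covering_pairs A x c -> [disjoint c.1 & c.2]%fset.
Proof.
move=> [_ _ [z oz zW]]; apply/fdisjointP => p pS; apply/negP => /zW[_].
by rewrite (orthogonalP z p).1 ?ltxx//; exact: oz.
Qed.

(** Orthogonality refers only to the vertices, so a simplex keeps its [z] when the ambient set
    changes; only the set of points with negative power is recomputed. *)
Lemma covering_pairs_setD A x F c : covering_pairs (A `\` [set` F]) x c <->
  [disjoint c.1 & F]%fset /\
  exists2 W, covering_pairs A x (c.1, W) & c.2 = (W `\` F)%fset.
Proof.
split=> [[[SA cS] hS [z oz zW]]|[/fdisjointP dSF [W [[SA cS] hS [z oz zW]] cW]]].
  split; first by apply/fdisjointP => p /SA[_ /negP].
  exists (c.2 `|` [fset b in F | `[< A b >] && (power z b < 0)])%fset.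
    split=> //; first by split=> // p /SA[].
    exists z => // b; rewrite !inE; split=> [[Ab zb]|/orP[/zW[[Ab _] zb]//|]].
      have [bF|bF] := boolP (b \in F); first by rewrite zb andbT asboolT// orbT.
      by rewrite (_ : b \in c.2)//; apply/zW; split=> //; split=> //; apply/negP.
    by move=> /andP[_ /andP[/asboolP]].
  apply/fsetP => b; rewrite !inE; have [bF|bF] /= := boolP (b \in F).
    by apply/negP => /zW[[_]] /=; rewrite bF.
  by rewrite orbF.
split=> //; first by split=> // p pS; split; [exact: SA | apply/negP/dSF].
exists z => // b; rewrite cW !inE; split=> [[[Ab /negP->] zb]|/andP[bF /zW[Ab zb]]].
  by apply/zW.
by split=> //; split=> //; exact/negP.
Qed.

(** By [covering_pairs_setD], these pairs are the ones whose second component becomes empty in [A]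
    minus [V], that is, they come from the one Delaunay simplex of [A] minus [V] covering [x]. *)
Lemma covering_pairs_unique A x V : generic_at A x ->
  exists! c, [/\ covering_pairs A x c, (c.2 `<=` V)%fset & [disjoint c.1 & V]%fset].
Proof.
move=> gA; have gAV := generic_at_setD V gA.
have [S [z [sS hS oz zA]]] := exists_delaunay d_gt0 gAV.
have : covering_pairs (A `\` [set` V]) x (S, fset0).
  split=> //; exists z => // b; rewrite inE; split=> // -[Ab].
  by rewrite ltNge zA.
move=> /covering_pairs_setD[/= dSV [W cSW /esym/eqP]]; rewrite fsetD_eq0 => WV.
exists (S, W); split=> // -[T W'] [/= cTW' W'V dTV].
have [/= sT hT [z' oz' z'W']] : covering_pairs (A `\` [set` V]) x (T, fset0).
  apply/covering_pairs_setD; split=> //; exists W' => //.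
  by apply/esym/eqP; rewrite fsetD_eq0.
have ST : S = T.
  apply: (delaunay_unique gAV sS sT hS hT oz oz' zA) => b Ab.
  by rewrite leNgt; apply/negP => zb; have /z'W' : (A `\` [set` V]) b /\ power z' b < 0.
by rewrite -ST in cTW' *; rewrite (covering_pairs_inj gA cSW cTW').
Qed.

(* A covering simplex other than the Delaunay simplex [c0.1] has a vertex of the
   latter in its violated set; removing that vertex lowers the heft. *)
Lemma finite_covering_pairs A x k : generic_at A x ->
  finite_set [set c | covering_pairs A x c /\ (#|` c.2| < k)%N].
Proof.
elim: k A => [|k IHk] A gA; first by apply: sub_finite_set (finite_set0 _) => c [].
have [c0 [[cov0 c02 _] _]] := covering_pairs_unique fset0 gA.
move: c02; rewrite fsubset0 => /eqP c02.
pose add p c := (c.1, p |` c.2)%fset.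
pose B p := [set c | covering_pairs (A `\` [set` [fset p]%fset]) x c /\ (#|` c.2| < k)%N].
apply: (@sub_finite_set _ _ ([set c0] `|` \bigcup_(p in [set` c0.1]) (add p @` B p))).
  (* If [c0.1] avoids [c.2], then [c0] and [c] are both the pair singled out by [V = c.2]. *)
  move=> c [cc ck]; have [dc|] := boolP [disjoint c0.1 & c.2]%fset.
    left; have [c1 [_ uc1]] := covering_pairs_unique c.2 gA.
    rewrite /= -(uc1 c); first by apply: uc1; rewrite c02 fsub0set.
    by split=> //; exact: covering_pairs_disjoint cc.
  rewrite -fsetI_eq0 => /fset0Pn[p]; rewrite inE => /andP[p0 pc]; right.
  exists p => //; exists (c.1, c.2 `\ p)%fset; last first.
    by case: c {cc ck} pc => S W /= pW; rewrite /add /= fsetD1K.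
  split; last by move: ck; rewrite (cardfsD1 p) pc.
  apply/covering_pairs_setD; split; last by exists c.2; case: (c) cc.
  rewrite fdisjointX1 /=; apply: contraL pc.
  by move: (covering_pairs_disjoint cc) => /fdisjointP; exact.
rewrite finite_setU; split=> //; apply: bigcup_finite => // p _.
by apply: finite_image; apply: IHk; exact: generic_at_setD.
Qed.

Lemma finite_covering_pairs_eq A x k : generic_at A x ->
  finite_set [set c | covering_pairs A x c /\ #|` c.2| = k].
Proof.
move=> gA; apply: sub_finite_set (finite_covering_pairs k.+1 gA) => c [cc <-].
by split.
Qed.

End CoveringPairs.

(** * Counting covering simplices and stars *)

Lemma card_fset_count (T : choiceType) (F : {fset T}) (P : pred T) :
  #|` [fset c in F | P c]%fset| = count P F.
Proof.
rewrite -size_filter; apply: perm_size; apply: uniq_perm => [||c].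
- exact: fset_uniq.
- exact/filter_uniq/fset_uniq.
- by rewrite mem_filter !inE andbC.
Qed.

Lemma card_set_fset_sub (T : choiceType) (F : {fset T}) (P : pred T) :
  #|[set i : F | P (val i)]%SET| = #|` [fset c in F | P c]%fset|.
Proof.
rewrite -(@card_fsub _ F); last by apply/fsubsetP => c; rewrite !inE => /andP[].
by apply: eq_card => i; rewrite in_fsub !inE (valP i).
Qed.

Lemma count_split (T : Type) (P Q : pred T) (s : seq T) :
  count P s = (count (fun c => P c && Q c) s + count (fun c => P c && ~~ Q c) s)%N.
Proof. by elim: s => //= c s ->; case: (P c); case: (Q c) => /=; lia. Qed.

Section CoveringCount.
Context {R : realType} {d : nat}.
Hypothesis d_gt0 : (0 < d)%N.
Local Notation pt := ('rV[R]_d * R)%type.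
Implicit Types (A : set pt) (x : 'rV[R]_d) (p q b z : pt) (S T W V F N : {fset pt}).
Implicit Types c : {fset pt} * {fset pt}.

(* Every [r]-subset [V] of a large finite set singles out one covering pair, and a
   pair with [#|` W| = k] is singled out by ['C(n - d.+1 - k, r - k)] of them. *)
Lemma card_covering_pairs A x k : generic_at A x ->
  #|` fset_set [set c | covering_pairs A x c /\ #|` c.2| = k]| = 'C(d + k, d).
Proof.
move=> gA; elim/ltn_ind: k => r IHr.
(* An [r]-subset can only single out a pair of heft at most [r], so [T] indexes all candidates. *)
have finT := finite_covering_pairs d_gt0 r.+1 gA.
pose T := fset_set [set c | covering_pairs A x c /\ (#|` c.2| < r.+1)%N].
have inT c : c \in T <-> covering_pairs A x c /\ (#|` c.2| <= r)%N.
  by rewrite /T in_fset_set// inE.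
clearbody T.
have levT k : (k <= r)%N ->
    fset_set [set c | covering_pairs A x c /\ #|` c.2| = k] =
    [fset c in T | #|` c.2| == k]%fset.
  move=> kr; apply/fsetP => c; rewrite in_fset_set; last exact: finite_covering_pairs_eq.
  rewrite !inE; apply/idP/andP => [/set_mem[cc /eqP ck]|[/inT[cc _] /eqP ck]].
    by split=> //; apply/inT; rewrite (eqP ck).
  by rewrite inE.
pose N0 := (\bigcup_(c <- T) (c.1 `|` c.2))%fset.
(* [N0] is padded by arbitrary weighted points to the size required by [card_unique_draw];
   [covering_pairs_unique] applies to every subset [V] of the result. *)
have [|||N [/fsubsetP N0N _ cN]] := @fsuperset_of_card _ setT N0 (maxn #|` N0| (d.+1 + r)).
- by move=> F; have [p _ pF] := exists_notin_fset d_gt0 F gA; exists p.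
- by [].
- exact: leq_maxl.
have NT c : c \in T -> (c.1 `<=` N)%fset /\ (c.2 `<=` N)%fset.
  move=> cT; split; apply/fsubsetP => p pc; apply: N0N; apply/bigfcupP;
  by exists c; rewrite ?cT// inE pc ?orbT.
have cardW (i : T) : #|fsub N (val i).2| = #|` (val i).2|.
  by apply: card_fsub; exact: (NT _ (valP i)).2.
have card_lev k : (k <= r)%N ->
    #|[set i : T | #|fsub N (val i).2| == k]%SET| =
    #|` fset_set [set c | covering_pairs A x c /\ #|` c.2| = k]|.
  move=> kr; rewrite levT// -card_set_fset_sub; apply: eq_card => i.
  by rewrite !inE cardW.
rewrite -card_lev//.
apply: (card_unique_draw (I := T) (S := fun i => fsub N (val i).1)
  (W := fun i => fsub N (val i).2)) => [i|i|i|V cV||k kr].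
- by rewrite card_fsub ?(NT _ (valP i)).1//; have /inT[[[]]] := valP i.
- apply: fdisjoint_sub; have /inT[cc _] := valP i.
  exact: covering_pairs_disjoint cc.
- by rewrite cardW; have /inT[] := valP i.
- pose V' : {fset pt} := [fsetval k in V]%fset.
  have V'N : (V' `<=` N)%fset by apply/fsubsetP => p /in_fset_valP[].
  have VE : V = fsub N V' by rewrite FSetK.
  have cV' : #|` V'| = r by rewrite -(card_fsub V'N) -VE.
  have drawP (i : T) : ((fsub N (val i).2 \subset V) && [disjoint fsub N (val i).1 & V]) =
      ((val i).2 `<=` V')%fset && [disjoint (val i).1 & V']%fset.
    have [N1 N2] := NT _ (valP i); rewrite VE subset_fsubE// disjoint_fsub//.
    by rewrite fsubUset N1.
  have [c [[cc cW cS] uc]] := covering_pairs_unique d_gt0 V' gA.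
  have cT : c \in T by apply/inT; split=> //; rewrite -cV' fsubset_leq_card.
  exists [` cT]%fset; split; first by apply/andP; rewrite drawP /= cW cS.
  move=> j /andP; rewrite drawP => /andP[jW jS]; apply/val_inj/uc; split=> //.
  by have /inT[] := valP j.
- by rewrite -cardfE cN leq_maxr.
- by rewrite card_lev ?IHr// ltnW.
Qed.

Lemma has_heftP A S k : has_heft A S k <->
  exists z W, [/\ orthogonal_to_all S z,
    forall b, (A b /\ power z b < 0) <-> b \in W & #|` W| = k].
Proof.
split=> [[z [oz zk]]|[z [W [oz zW cW]]]]; last first.
  exists z; split=> //; rewrite (_ : [set b | _] = [set` W]).
    exact/card_eq_fsetP.
  by apply/seteqP; split=> b /zW.
have fin : finite_set [set b | A b /\ power z b < 0] by apply/finite_setP; exists k.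
exists z, (fset_set [set b | A b /\ power z b < 0]); split=> //.
  by move=> b; rewrite in_fset_set// inE.
exact: card_fset_set.
Qed.

Lemma covering_at_simplices_heft A x k : covering_at (simplices_heft A k) x =
  fst @` [set c | covering_pairs A x c /\ #|` c.2| = k].
Proof.
apply/seteqP; split=> S.
  move=> [[sS /has_heftP[z [W [oz zW cW]]]] hS].
  by exists (S, W) => //=; split=> //; split=> //; exists z.
move=> [c [[sS hS [z oz zW]] cW] <-]; split=> //; split=> //.
by apply/has_heftP; exists z, c.2.
Qed.

Lemma card_covering_simplices_heft A x k : generic_at A x ->
  (covering_at (simplices_heft A k) x #= `I_('C(d + k, d)))%card.
Proof.
move=> gA; rewrite covering_at_simplices_heft.
set B := [set c | _]; have injB : {in B &, injective fst}.
  move=> [S W] [S' W'] /set_mem[cc _] /set_mem[cc' _] /= SS'.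
  by rewrite -SS' in cc' *; rewrite (covering_pairs_inj gA cc cc').
rewrite (card_eql (inj_card_eq injB)).
have finB : finite_set B by exact: finite_covering_pairs_eq.
by rewrite -(fset_setK finB); apply/card_eq_fsetP; exact: card_covering_pairs.
Qed.

(* Removing [p] turns the pairs with [p \in W] into pairs of heft one less, so
   comparing the counts for [A] and for [A] without [p] telescopes. *)
Lemma card_covering_star A x p k : generic_at A x ->
  (#|` fset_set [set c | (covering_pairs A x c /\ (#|` c.2| < k.+1)%N) /\
    p \in c.1]| <= 'C(d + k, d))%N.
Proof.
move=> gA.
(* Hefts up to [k.+1] are kept, because a pair of heft [k] for [A] minus [p] may come from one of
   heft [k.+1] for [A]. *)
have finT := finite_covering_pairs d_gt0 k.+2 gA.
pose T := fset_set [set c | covering_pairs A x c /\ (#|` c.2| < k.+2)%N].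
have inT c : c \in T <-> covering_pairs A x c /\ (#|` c.2| <= k.+1)%N.
  by rewrite /T in_fset_set// inE.
clearbody T.
pose n (P : pred ({fset pt} * {fset pt})) := count P T.
have disj c : c \in T -> p \in c.1 -> p \notin c.2.
  by move=> /inT[/covering_pairs_disjoint/fdisjointP h _]; exact: h.
have heft j : (j <= k)%N -> n (fun c => #|` c.2| == j) = 'C(d + j, d).
  move=> jk; rewrite -(card_covering_pairs j gA) /n -card_fset_count; congr (#|` _ |).
  apply/fsetP => c; rewrite in_fset_set; last exact: finite_covering_pairs_eq.
  rewrite !inE; apply/andP/idP => [[/inT[cc _] /eqP ck]|/set_mem[cc ck]].
    by rewrite inE.
  by split; [apply/inT; split=> //; lia | exact/eqP].
pose f c := (c.1, c.2 `\ p)%fset.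
have gAp := generic_at_setD [fset p]%fset gA.
have heftD j : (j <= k)%N ->
    n (fun c => (p \notin c.1) && (#|` (c.2 `\ p)%fset| == j)) = 'C(d + j, d).
  move=> jk; rewrite -(card_covering_pairs j gAp) /n -card_fset_count.
  set B := [fset c in T | _]%fset.
  have /card_in_imfsetP/eqP <- : {in B &, injective f}.
    move=> [S W] [S' W']; rewrite !inE /= => /andP[/inT[cc _] _] /andP[/inT[cc' _] _].
    by move=> [SS' _]; rewrite -SS' in cc' *; rewrite (covering_pairs_inj gA cc cc').
  congr (#|` _ |); apply/fsetP => c.
  rewrite in_fset_set; last exact: finite_covering_pairs_eq.
  apply/imfsetP/idP => /= [[[S W]]|/set_mem[/covering_pairs_setD[dc [W cc cW]] cj]].
    move=> + ->; rewrite !inE /= => /andP[/inT[cc _] /andP[pS /eqP cj]]; split=> //.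
    by apply/covering_pairs_setD; split; [rewrite fdisjointX1 | exists W].
  exists (c.1, W); last by rewrite /f /= -cW; case: (c).
  rewrite !inE /= -cW cj eqxx andbT -fdisjointX1 dc andbT; apply/inT; split=> //=.
  by rewrite (cardfsD1 p) -cW cj; case: (p \in W); lia.
(* [E1] splits the pairs of heft [j] for [A] according to whether [p] is a vertex, lies in [c.2], or
   neither. [E2] splits those for [A] minus [p], where pairs counted by [inn j.+1] have dropped to
   heft [j]. *)
pose inn j := n (fun c => (p \in c.2) && (#|` c.2| == j)).
pose out j := n (fun c => [&& p \notin c.1, p \notin c.2 & #|` c.2| == j]).
have E2 j : (j <= k)%N -> 'C(d + j, d) = (inn j.+1 + out j)%N.
  move=> jk; rewrite -heftD// /n (count_split _ (fun c => p \in c.2)).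
  congr (_ + _)%N; apply: eq_in_count => c cT /=.
    have := disj _ cT; case: (p \in c.1) => /=.
      by move=> /(_ isT)/negbTE->.
    by move=> _; case pW: (p \in c.2); rewrite ?andbF//= (cardfsD1 p c.2) pW andbT eqSS.
  case: (p \in c.1) => //=; have [|pW] /= := boolP (p \in c.2); first by rewrite andbF.
  by rewrite andbT (fsetDidPl _ _ _) ?fdisjointX1.
have E1 j : (j <= k)%N -> 'C(d + j, d) =
    (n (fun c => (p \in c.1) && (#|` c.2| == j)) + (inn j + out j))%N.
  move=> jk; rewrite -heft// /n (count_split _ (fun c => p \in c.1)).
  congr (_ + _)%N; first by apply: eq_count => c; rewrite andbC.
  rewrite (count_split _ (fun c => p \in c.2)); congr (_ + _)%N.
    apply: eq_in_count => c cT /=; have := disj _ cT.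
    by case: (p \in c.1) => /= [/(_ isT)/negbTE->|_]; rewrite ?andbF ?andbT// andbC.
  by apply: eq_count => c /=; rewrite -andbA andbC andbA.
(* Comparing [E1] and [E2], the star of [p] has [inn j.+1 - inn j] pairs of heft exactly [j]; the
   sum telescopes from [inn 0 = 0]. *)
have star j : (j <= k)%N ->
    n (fun c => (p \in c.1) && (#|` c.2| <= j)%N) = inn j.+1.
  elim: j => [|j IHj] jk.
    have := E1 0%N jk; rewrite (E2 0%N jk).
    have -> : inn 0%N = 0%N.
      apply/eqP; rewrite -leqn0 leqNgt -has_count; apply/hasP => -[c _].
      by rewrite cardfs_eq0 => /andP[pc /eqP c0]; rewrite c0 in pc.
    have -> : n (fun c => (p \in c.1) && (#|` c.2| <= 0)%N) =
              n (fun c => (p \in c.1) && (#|` c.2| == 0)%N).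
      by apply: eq_count => c; rewrite leqn0.
    by lia.
  have := E1 _ jk; rewrite (E2 _ jk).
  have -> : n (fun c => (p \in c.1) && (#|` c.2| <= j.+1)%N) =
      (n (fun c => (p \in c.1) && (#|` c.2| == j.+1)%N) +
       n (fun c => (p \in c.1) && (#|` c.2| <= j)%N))%N.
    rewrite /n (count_split _ (fun c => #|` c.2| == j.+1)).
    congr (_ + _)%N; apply: eq_count => c /=; case: (p \in c.1) => //=; lia.
  by rewrite IHj 1?ltnW//; lia.
apply: (@leq_trans (inn k.+1)); last by rewrite E2// leq_addr.
rewrite -star// /n -card_fset_count; apply: fsubset_leq_card.
apply/fsubsetP => c; rewrite in_fset_set.
  move=> /set_mem[[cc ck] pc]; rewrite !inE pc /=; apply/andP; split=> //.
  by apply/inT; split=> //; exact: ltnW.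
by apply: sub_finite_set (finite_covering_pairs d_gt0 k.+1 gA) => c' [].
Qed.

(** Since locations are distinct, a vertex located at [p.1] is [p] itself, so [card_covering_star]
    applies. *)
Lemma card_covering_star_heft_le A x p k : generic_at A x -> A p ->
  (covering_at (star_heft_le A p.1 k) x #<= `I_('C(d + k, d)))%card.
Proof.
move=> gA Ap; set B := [set c | (covering_pairs A x c /\ (#|` c.2| < k.+1)%N) /\ p \in c.1].
have finB : finite_set B.
  by apply: sub_finite_set (finite_covering_pairs d_gt0 k.+1 gA) => c [].
apply: (@card_le_trans _ _ _ (fst @` B)).
  apply: subset_card_le => S [[sS [j jk /has_heftP[z [W [oz zW cW]]]] [q qS qp]] hS].
  exists (S, W) => //; split; first by split; [split=> //; exists z | rewrite /= cW].
  have [[inj _ _] _ _] := gA; rewrite (inj p q)//; exact: (sS.1 _ qS).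
apply: card_le_trans (card_image_le _ _) _.
have cB : (B #= `I_#|` fset_set B|)%card.
  by rewrite -[X in (X #= _)%card](fset_setK finB); apply/card_eq_fsetP.
by rewrite (card_le_eql cB) card_le_II; exact: card_covering_star.
Qed.

End CoveringCount.

Unset Implicit Arguments.

Theorem theorem6 (R : realType) (d : nat) (hd : (1 <= d)%N)
    (AA : set ('rV[R]_d * R))
    (hthin : wthin_delone AA) (hgen : wgeneric AA)
    (k : nat) (a : 'rV[R]_d) (ha : locations AA a) :
  covers_exactly (locations AA) (simplices_heft AA k) setT 'C(d + k, d) /\
  (exists2 V : set 'rV[R]_d, nbhs a V &
     forall U : set 'rV[R]_d, nbhs a U -> U `<=` V ->
       covers_at_most (locations AA) (star_heft_le AA a k) U 'C(d + k, d)).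
Proof.
split=> [x _ gx|]; first exact: card_covering_simplices_heft.
exists setT; first exact: filterT.
have [p Ap <-] := ha => U _ _ x _ gx; exact: card_covering_star_heft_le.
Qed.
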